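(* Let $\theta$ be a real number and let $G$ be a $\theta$-super positive graph. Let $Y\subseteq E(G)$ be the set of all $\theta$-extreme edges of $G$, and let $G-Y$ be the graph with vertex set $V(G)$ and edge set $E(G)\setminus Y$. Then $G-Y$ is a disjoint union of $\theta$-base graphs (each connected component of $G-Y$ is a $\theta$-base graph). In particular, $G$ can be decomposed into a disjoint union of $\theta$-base graphs by deleting its $\theta$-extreme edges, and this decomposition (i.e. these $\theta$-base graphs) is uniquely determined by $G$.
   Context: All graphs are finite and simple. For a graph $G$ on $n$ vertices, let $p(G,r)$ be the number of $r$-matchings ($r$ pairwise disjoint edges) in $G$, with $p(G,0)=1$; the matching polynomial is $\mu(G,x)=\sum_{r=0}^{\lfloor n/2\rfloor}(-1)^r p(G,r)x^{n-2r}$ (the graph with no vertices has $\mu=1$). For real $\theta$, $\mathrm{mult}(\theta,G)$ denotes the multiplicity of $\theta$ as a root of $\mu(G,x)$ (0 if not a root). For $X\subseteq V(G)$, $G\setminus X$ is the graph obtained by deleting the vertices of $X$ and all incident edges; $G\setminus uv$ means $G\setminus\{u,v\}$. A vertex $u$ is $\theta$-essential if $\mathrm{mult}(\theta,G\setminus u)=\mathrm{mult}(\theta,G)-1$, and $\theta$-positive if $\mathrm{mult}(\theta,G\setminus u)=\mathrm{mult}(\theta,G)+1$. A graph $G$ is $\theta$-super positive if $\mathrm{mult}(\theta,G)=0$ and every vertex of $G$ is $\theta$-positive (equivalently $\mu(G,\theta)\ne0$ and $\mu(G\setminus v,\theta)=0$ for all $v$). A graph is $\theta$-critical if all its vertices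 are $\theta$-essential and $\mathrm{mult}(\theta,G)=1$; $c_\theta(G)$ denotes the number of connected components of $G$ that are $\theta$-critical. A set $X\subseteq V(G)$ is a $\theta$-barrier set if $\mathrm{mult}(\theta,G)=c_\theta(G\setminus X)-|X|$, and a $\theta$-extreme set if $\mathrm{mult}(\theta,G\setminus X)=\mathrm{mult}(\theta,G)+|X|$. $\mathfrak P(\theta,G)$ denotes the set of all $\theta$-barrier sets of $G$. A set of vertices is independent if no two of its vertices are adjacent. A graph $G$ is $\theta$-base if it is $\theta$-super positive and every $S\in\mathfrak P(\theta,G)$ is independent. For a $\theta$-super positive graph $G$, an edge $(u,v)\in E(G)$ is $\theta$-extreme if $\{u,v\}$ is a $\theta$-extreme set of $G$. *)

(* Defs.v *)
From HB Require Import structures.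
From mathcomp Require Import all_boot all_order all_algebra.
From mathcomp Require Import reals.

Set Implicit Arguments.
Unset Strict Implicit.
Unset Printing Implicit Defensive.

Import GRing.Theory.
Local Open Scope ring_scope.

(* Finite simple graphs whose vertices are taken in an ambient finite type T.
   The vertex set may be a proper subset of T, so that all subgraphs of a graph
   live in the same type; an edge is a set of two vertices. *)
Record sgraph (T : finType) := SGraph {
  sgraph_val : {set T} * {set {set T}};
  sgraph_wf : [forall e in sgraph_val.2,
                 (e \subset sgraph_val.1) && (#|e| == 2)%N] }.

HB.instance Definition _ (T : finType) := [isSub for @sgraph_val T].
HB.instance Definition _ (T : finType) := [Countable of sgraph T by <:].
HB.instance Definition _ (T : finType) := [Finite of sgraph T by <:].

Definition vertices (T : finType) (G : sgraph T) : {set T} := (val G).1.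
Definition edges (T : finType) (G : sgraph T) : {set {set T}} := (val G).2.
Definition adj (T : finType) (G : sgraph T) : rel T :=
  fun x y => [set x; y] \in edges G.

Lemma induced_wf (T : finType) (G : sgraph T) (X : {set T}) :
  let E := [set e in edges G | e \subset X] in
  [forall e in E, (e \subset vertices G :&: X) && (#|e| == 2)%N].
Proof.
apply/forall_inP => e; rewrite inE subsetI => /andP[eG ->].
by rewrite andbT (forall_inP (sgraph_wf G) e eG).
Qed.

Definition induced (T : finType) (G : sgraph T) (X : {set T}) : sgraph T :=
  @SGraph T (vertices G :&: X, [set e in edges G | e \subset X])
    (induced_wf G X).

Definition del_vertices (T : finType) (G : sgraph T) (X : {set T}) : sgraph T :=
  induced G (~: X).

Lemma del_edges_wf (T : finType) (G : sgraph T) (Z : {set {set T}}) :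
  [forall e in edges G :\: Z, (e \subset vertices G) && (#|e| == 2)%N].
Proof.
apply/forall_inP => e; rewrite inE => /andP[_ eG].
exact: (forall_inP (sgraph_wf G) e eG).
Qed.

Definition del_edges (T : finType) (G : sgraph T) (Z : {set {set T}}) :
    sgraph T :=
  @SGraph T (vertices G, edges G :\: Z) (del_edges_wf G Z).

Definition components (T : finType) (G : sgraph T) : {set sgraph T} :=
  [set induced G C | C in equivalence_partition (connect (adj G)) (vertices G)].

(* The graph without vertices is not connected: it has no component. *)
Definition connected_graph (T : finType) (G : sgraph T) : bool :=
  #|components G| == 1%N.

Definition independent (T : finType) (G : sgraph T) (S : {set T}) : bool :=
  [forall x in S, forall y in S, ~~ adj G x y].

Definition is_disjoint_union (T : finType) (G : sgraph T)
    (F : {set sgraph T}) : Prop :=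
  [/\ {in F &, forall H K, H != K -> [disjoint vertices H & vertices K]},
      vertices G = \bigcup_(H in F) vertices H
    & edges G = \bigcup_(H in F) edges H].

Definition num_matchings (T : finType) (G : sgraph T) (r : nat) : nat :=
  #|[set M : {set {set T}} | [&& M \subset edges G, trivIset M & #|M| == r]]|.

Definition matching_poly (R : nzRingType) (T : finType) (G : sgraph T) :
    {poly R} :=
  let n := #|vertices G| in
  \sum_(r < (n./2).+1)
     ((-1) ^+ r * (num_matchings G r)%:R) *: 'X^(n - 2 * r).

Definition mult (R : fieldType) (T : finType) (theta : R) (G : sgraph T) :
    nat :=
  mup theta (matching_poly R G).

Definition essential (R : fieldType) (T : finType) (theta : R)
    (G : sgraph T) (u : T) : bool :=
  (mult theta (del_vertices G [set u])).+1 == mult theta G.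

Definition positive (R : fieldType) (T : finType) (theta : R)
    (G : sgraph T) (u : T) : bool :=
  mult theta (del_vertices G [set u]) == (mult theta G).+1.

Definition super_positive (R : fieldType) (T : finType) (theta : R)
    (G : sgraph T) : bool :=
  (mult theta G == 0%N) && [forall u in vertices G, positive theta G u].

Definition critical (R : fieldType) (T : finType) (theta : R)
    (G : sgraph T) : bool :=
  [forall u in vertices G, essential theta G u] && (mult theta G == 1%N).

Definition num_critical (R : fieldType) (T : finType) (theta : R)
    (G : sgraph T) : nat :=
  #|[set C in components G | critical theta C]|.

(* Truncated subtraction is avoided by moving #|X| to the other side. *)
Definition barrier_set (R : fieldType) (T : finType) (theta : R)
    (G : sgraph T) (X : {set T}) : bool :=
  (X \subset vertices G) &&
  (mult theta G + #|X| == num_critical theta (del_vertices G X))%N.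

Definition extreme_set (R : fieldType) (T : finType) (theta : R)
    (G : sgraph T) (X : {set T}) : bool :=
  (X \subset vertices G) &&
  (mult theta (del_vertices G X) == mult theta G + #|X|)%N.

Definition base_graph (R : fieldType) (T : finType) (theta : R)
    (G : sgraph T) : bool :=
  super_positive theta G &&
  [forall S : {set T}, barrier_set theta G S ==> independent G S].

Definition extreme_edges (R : fieldType) (T : finType) (theta : R)
    (G : sgraph T) : {set {set T}} :=
  [set e in edges G | extreme_set theta G e].

(* Arbitrary disjoint unions of theta-base graphs can themselves be
   theta-base, so the pieces of a decomposition are required to be connected.
   The deleted edges Z may be any set of theta-extreme edges. *)
Definition base_decomposition (R : fieldType) (T : finType) (theta : R)
    (G : sgraph T) (F : {set sgraph T}) : Prop :=
  {in F, forall H, connected_graph H && base_graph theta H} /\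
  exists2 Z : {set {set T}}, Z \subset extreme_edges theta G
    & is_disjoint_union (del_edges G Z) F.

(* Main.v *)
(** The engine is the inequality mu(G\u) mu(G\v) - mu(G) mu(G\uv) >= 0 on the
    real line, with lower bound mu(G\uv)^2 when uv is an edge. Comparing orders
    of vanishing at theta on the two sides of such inequalities gives the
    interlacing of multiplicities, the bound mult(G) <= mult(G\uv) + 1 for an
    edge uv, and the fact that a vertex adjacent to an essential one is
    essential or positive. Perturbing the weight of one vertex turns the
    inequality into a nonnegative quadratic polynomial; its discriminant shows
    that "v is not essential in G\u" is a transitive relation when all vertices
    are essential, whence Gallai's lemma: a connected graph all of whose
    vertices are essential has multiplicity one.

    Consequently the components of a graph without positive vertices are
    critical or have multiplicity zero. Removing a maximal extreme set therefore
    leaves as many critical components as it has vertices, so every extreme set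
    lies in a barrier set; hence a super positive graph is a base graph iff it
    has no extreme edge. Deleting an extreme edge e from a super positive graph
    keeps it super positive with the same other extreme edges, because
    mult(G\e) = 2 and so mult stays positive after deleting from G\e one more
    vertex or both ends of one more edge. *)
Require Import Defs.
From mathcomp Require Import all_boot all_order all_algebra.
From mathcomp Require Import reals.
From mathcomp Require Import polyrcf ring lra zify.

Set Implicit Arguments.
Unset Strict Implicit.
Unset Printing Implicit Defensive.

Import Order.TTheory GRing.Theory Num.Theory.
Local Open Scope ring_scope.

(** * Order of vanishing and polynomial inequalities *)

Section PolynomialInequalities.
Variable R : rcfType.
Implicit Types (p q r : {poly R}) (t : R) (m n : nat).

Lemma neg_neighborhood r t :
  r.[t] < 0 -> exists2 d, 0 < d & forall y, `|y - t| < d -> r.[y] < 0.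
Proof.
move=> rt; have [|d d0 dP] := @poly_cont R t r (- r.[t]); first by rewrite oppr_gt0.
exists d => // y /dP; rewrite ltr_norml => /andP[_]; lra.
Qed.

Lemma horner_ge0_right r t : (forall x, t < x -> 0 <= r.[x]) -> 0 <= r.[t].
Proof.
move=> rP; rewrite leNgt; apply/negP => /neg_neighborhood[d d0 dP].
have /dP : `|t + d / 2 - t| < d by rewrite addrC addKr ger0_norm; lra.
by rewrite ltNge rP //; lra.
Qed.

Lemma horner_ge0_left r t : (forall x, x < t -> 0 <= r.[x]) -> 0 <= r.[t].
Proof.
move=> rP; rewrite leNgt; apply/negP => /neg_neighborhood[d d0 dP].
have /dP : `|t - d / 2 - t| < d by rewrite addrAC subrr sub0r normrN ger0_norm; lra.
by rewrite ltNge rP //; lra.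
Qed.

Lemma horner_mul_XsubC_exp r t x n :
  (r * ('X - t%:P) ^+ n).[x] = r.[x] * (x - t) ^+ n.
Proof. by rewrite hornerM horner_exp hornerXsubC. Qed.

(** Write [q] as [s] times the odd power. Off [t] the product [s.[x] * (x - t)] is nonnegative, so
    approaching [t] from both sides gives [s.[t] = 0]. *)
Lemma nneg_root_order_even q t m : (forall x, 0 <= q.[x]) ->
  ('X - t%:P) ^+ m.*2.+1 %| q -> ('X - t%:P) ^+ m.*2.+2 %| q.
Proof.
move=> q0 /dvdpP[s qE]; have {}q0 x : 0 <= s.[x] * (x - t) * ((x - t) ^+ m) ^+ 2.
  by rewrite -exprM muln2 -mulrA -exprS; have := q0 x; rewrite qE horner_mul_XsubC_exp.
have q1 x : x != t -> 0 <= s.[x] * (x - t).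
  move=> xt; have := q0 x; rewrite pmulr_lge0 // exprn_even_gt0 //=.
  by rewrite expf_eq0 subr_eq0 (negPf xt) andbF.
have s1 : 0 <= s.[t].
  apply: horner_ge0_right => x tx; have := q1 x.
  by rewrite gt_eqF // => /(_ isT); rewrite pmulr_lge0 // subr_gt0.
have s2 : 0 <= (- s).[t].
  apply: horner_ge0_left => x tx; have := q1 x; rewrite lt_eqF // => /(_ isT).
  by rewrite hornerN nmulr_lge0 ?subr_lt0 // oppr_ge0.
have /factor_theorem[s' sE] : root s t.
  by rewrite rootE eq_le s1 -oppr_ge0 -hornerN s2.
by rewrite qE sE -mulrA -exprS dvdp_mulIr.
Qed.

(** Each induction step divides both sides by the even power already known to divide them. What
    remains is [p1 ^+ 2 <= q1 * (x - t)] to the right of [t], and letting [x] tend to [t] makes [t]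
    a root of [p1]. *)
Lemma sqr_le_root_order p q t m : (forall x, p.[x] ^+ 2 <= q.[x]) ->
  ('X - t%:P) ^+ m.*2.+1 %| q -> ('X - t%:P) ^+ m.+1 %| p.
Proof.
elim: m => [|m IH] pq qdvd.
  rewrite expr1 dvdp_XsubCl rootE -sqrf_eq0 eq_le sqr_ge0 andbT.
  have : root q t by rewrite -dvdp_XsubCl -[_ - _]expr1.
  by move=> /rootP <-.
have /dvdpP[p1 pE] := IH pq (dvdp_trans (dvdp_exp2l _ (leq_addl 2 _)) qdvd).
have /dvdpP[q1 qE] := qdvd.
have rP x : t < x -> 0 <= (q1 * ('X - t%:P) - p1 ^+ 2).[x].
  move=> tx; rewrite !hornerE; have := pq x; rewrite pE qE !horner_mul_XsubC_exp -subr_ge0.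
  have -> : q1.[x] * (x - t) ^+ m.+1.*2.+1 - (p1.[x] * (x - t) ^+ m.+1) ^+ 2
      = (q1.[x] * (x - t) - p1.[x] ^+ 2) * ((x - t) ^+ m.+1) ^+ 2.
    by rewrite exprMn -exprM muln2 exprS; ring.
  by rewrite pmulr_lge0 // !exprn_gt0 // subr_gt0.
have /factor_theorem[p2 p2E] : root p1 t.
  have := horner_ge0_right rP; rewrite !(hornerE, horner_exp) subrr mulr0 sub0r.
  by rewrite oppr_ge0 rootE -sqrf_eq0 eq_le sqr_ge0 andbT.
by rewrite pE p2E -mulrA -exprS dvdp_mulIr.
Qed.

Lemma dvdp_deriv_XsubC_exp p t n :
  ('X - t%:P) ^+ n %| p -> ('X - t%:P) ^+ n.-1 %| p^`().
Proof.
case: n => [|n]; first by move=> _; rewrite expr0 dvd1p.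
move=> /dvdpP[s ->]; rewrite derivM deriv_exp /= -mulrnAl.
by rewrite dvdp_add ?dvdp_mull // ?exprS ?dvdp_mulIr // ?dvdp_mull.
Qed.

(** Modulo [('X - t%:P) ^+ n], the derivative of [s * ('X - t%:P) ^+ n] is [n] times
    [s * ('X - t%:P) ^+ n.-1]. Since [n] is nonzero in characteristic zero, [s] vanishes at [t]. *)
Lemma dvdp_XsubC_expS p t n : (0 < n)%N ->
  ('X - t%:P) ^+ n %| p -> ('X - t%:P) ^+ n %| p^`() -> ('X - t%:P) ^+ n.+1 %| p.
Proof.
case: n => // n _ /dvdpP[s ->]; rewrite derivM deriv_exp derivXsubC mul1r /=.
rewrite dvdp_addr ?dvdp_mulIr // exprS mulrnAr -mulrnAl.
rewrite dvdp_mul2r ?expf_neq0 ?polyXsubC_eq0 // dvdp_XsubCl rootE hornerMn.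
rewrite mulrn_eq0 /= => /factor_theorem[s' ->].
by rewrite -mulrA -!exprS dvdp_mulIr.
Qed.

Lemma discriminant_le (K : realFieldType) (a b c : K) : 0 <= c ->
  (forall y, 0 <= a + b * y + c * y ^+ 2) -> b ^+ 2 <= 4 * a * c.
Proof.
rewrite le0r => /orP[/eqP-> h|c0 h].
  rewrite mulr0; have [->|b0] := eqVneq b 0; first by rewrite expr0n.
  (* For [c = 0] and [b != 0] the value at this point is [-1]. *)
  have := h (- (a + 1) / b); rewrite mul0r addr0 mulrC divfK //; lra.
(* The vertex of the parabola. *)
have := h (- b / (2 * c)).
have -> : a + b * (- b / (2 * c)) + c * (- b / (2 * c)) ^+ 2 = (4 * a * c - b ^+ 2) / (4 * c).
  by field; rewrite gt_eqF.
by rewrite pmulr_lge0 ?subr_ge0 // invr_gt0; lra.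
Qed.

End PolynomialInequalities.

(** * Weighted matching polynomials *)

(** The condition on [cover M] selects the matchings of the subgraph induced on [V]. Deleting
    vertices thus changes only [V], and [E] stays fixed. *)
Definition matchings (T : finType) (E : {set {set T}}) (V : {set T}) :=
  [set M : {set {set T}} | [&& M \subset E, trivIset M & cover M \subset V]].

(* Separate weights on the vertices allow perturbing the weight of one vertex;
   the matching polynomial is recovered by giving every vertex the weight 'X. *)
Definition wmatch (A : comNzRingType) (T : finType) (E : {set {set T}})
    (x : T -> A) (V : {set T}) : A :=
  \sum_(M in matchings E V) (-1) ^+ #|M| * \prod_(v in V :\: cover M) x v.

Section WeightedMatchings.
Variables (A : comNzRingType) (T : finType).
Implicit Types (E M : {set {set T}}) (V e : {set T}) (x : T -> A) (u v w : T).

Lemma eq_wmatch E x x' V : {in V, x =1 x'} -> wmatch E x V = wmatch E x' V.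
Proof.
move=> xx'; apply: eq_bigr => M _; congr (_ * _); apply: eq_bigr => v.
by rewrite inE => /andP[_ /xx'].
Qed.

Lemma matching_edge_subset E V M e : M \in matchings E V -> e \in M -> e \subset V.
Proof. by rewrite inE => /and3P[_ _ MV] eM; apply: subset_trans MV; apply: (bigcup_sup e). Qed.

Lemma eq_wmatch_edges E E' x V :
    (forall e, e \subset V -> (e \in E) = (e \in E')) ->
  wmatch E x V = wmatch E' x V.
Proof.
move=> EE'; apply: eq_bigl => M; rewrite !inE.
have [MV|] := boolP (cover M \subset V); last by rewrite !andbF.
congr (_ && _); apply/subsetP/subsetP => h e eM;
  by have := h e eM; rewrite EE' //; apply: subset_trans MV; apply: bigcup_sup.
Qed.

(** Removing [e] is a bijection onto the matchings of [V :\: e]; it loses one edge, whence the sign.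
    A matching of [V :\: e] cannot contain [e], because [e] is nonempty. *)
Lemma wmatch_with_edge E x V e : e \in E -> e \subset V -> e != set0 ->
  \sum_(M in matchings E V | e \in M) (-1) ^+ #|M| * \prod_(v in V :\: cover M) x v
    = - wmatch E x (V :\: e).
Proof.
move=> eE eV e0; rewrite (reindex_onto (fun M => e |: M) (fun M => M :\ e)) /=; last first.
  by move=> M /andP[_ eM]; rewrite setD1K.
rewrite /wmatch -sumrN; apply: eq_big => [M|M].
  rewrite !inE eqxx /= andbT; apply/andP/and3P => [[/and3P[ME tM MV] /eqP M_E]|[ME tM MV]].
    have eM : e \notin M by rewrite -M_E !inE eqxx.
    split; [|by apply: trivIsetS tM; rewrite subsetUr|].
      by apply: subset_trans ME; rewrite subsetUr.
    apply/bigcupsP => f fM; rewrite subsetD.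
    rewrite (subset_trans _ MV) ?bigcup_sup ?inE ?fM ?orbT //=.
    have /trivIsetP/(_ f e) := tM; rewrite !inE eqxx fM orbT => /(_ isT isT); apply.
    by apply: contraNneq eM => <-.
  have eM : e \notin M.
    apply/negP => eM; have /subsetP eVe : e \subset V :\: e.
      by apply: subset_trans MV; apply: bigcup_sup.
    by have /set0Pn[z ze] := e0; have := eVe z ze; rewrite inE ze.
  split; last by rewrite setU1K.
  apply/and3P; split.
  - by rewrite subUset sub1set eE.
  - have dis f : f \in M -> [disjoint e & f].
      move=> fM; rewrite disjoint_sym; move: MV => /bigcupsP/(_ f fM).
      by rewrite subsetD => /andP[].
    apply/trivIsetP => f g; rewrite !inE => /orP[/eqP->|fM] /orP[/eqP->|gM].
    + by rewrite eqxx.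
    + by move=> _; apply: dis.
    + by move=> _; rewrite disjoint_sym; apply: dis.
    + by have /trivIsetP := tM; apply.
  - rewrite /cover big_setU1 //= subUset eV /=.
    by apply: subset_trans MV _; rewrite subsetDl.
rewrite !inE => /andP[_ /eqP M_E]; have eM : e \notin M by rewrite -M_E !inE eqxx.
by rewrite cardsU1 eM /cover big_setU1 //= exprS setDDl mulN1r mulNr.
Qed.

Lemma wmatch_del_edge E x V e : e \in E -> e \subset V -> e != set0 ->
  wmatch E x V = wmatch (E :\ e) x V - wmatch E x (V :\: e).
Proof.
move=> eE eV e0; rewrite -wmatch_with_edge // addrC /wmatch (bigID (fun M => e \in M)) /=.
congr (_ + _); apply: eq_bigl => M; rewrite !inE subsetD1.
by rewrite andbC -andbA andbA [(e \notin M) && _]andbC -andbA.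
Qed.

Lemma set2C u v : [set u; v] = [set v; u]. Proof. exact: setUC. Qed.

Lemma set2_inj u v w : [set u; v] = [set u; w] -> v != u -> v = w.
Proof.
move=> /setP/(_ v); rewrite !inE eqxx orbT => /esym/orP[]/eqP-> //.
by rewrite eqxx.
Qed.

Lemma wmatch0 E x : set0 \notin E -> wmatch E x set0 = 1.
Proof.
move=> E0; rewrite /wmatch (big_pred1 set0) => [|M].
  by rewrite cards0 expr0 mul1r big_pred0 // => v; rewrite !inE andbF.
rewrite !inE; apply/and3P/eqP => [[ME _]|->].
  rewrite subset0 => /eqP cM; apply/setP => e; rewrite inE; apply/negP => eM.
  have : e \subset set0 by rewrite -cM; apply: bigcup_sup.
  by rewrite subset0 => /eqP eE; case/negP: E0; rewrite -eE (subsetP ME).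
by rewrite sub0set /cover big_set0 sub0set; split=> //; apply/trivIsetP => f; rewrite inE.
Qed.

(** Either [u] is uncovered and contributes the factor [x u], or it is matched to a unique neighbour
    [w]; the matchings of the second kind are sorted by [w]. *)
Lemma wmatch_vertex E x V u : (forall e, e \in E -> #|e| = 2) -> u \in V ->
  wmatch E x V = x u * wmatch E x (V :\ u)
    - \sum_(w in V :\ u) ([set u; w] \in E)%:R * wmatch E x (V :\ u :\ w).
Proof.
move=> E2 uV; rewrite {1}/wmatch (bigID (fun M => u \in cover M)) /= addrC.
congr (_ + _).
  rewrite mulr_sumr; apply: eq_big => [M|M].
    by rewrite !inE subsetD1 -!andbA.
  rewrite !inE => /andP[_ uM]; rewrite mulrCA; congr (_ * _).
  rewrite (big_setD1 u) ?inE ?uM //=; congr (_ * _).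
  by apply: eq_bigl => v; rewrite !inE andbCA.
(* The partner of [u] in [M]; the default [u] does not occur for a matching that covers [u]. *)
pose other M := odflt u [pick w | (w != u) && ([set u; w] \in M)].
have otherP M w : M \in matchings E V -> u \in cover M ->
    (other M == w) = (w != u) && ([set u; w] \in M).
  move=> MV uM; have Mu w1 w2 : w1 != u -> [set u; w1] \in M -> [set u; w2] \in M -> w1 = w2.
    move=> w1u m1 m2; apply: set2_inj w1u; apply/eqP/negPn/negP => ne.
    have := MV; rewrite inE => /and3P[_ /trivIsetP/(_ _ _ m1 m2 ne)].
    by rewrite disjoints_subset => /subsetP/(_ u); rewrite !inE eqxx => /(_ isT).
  rewrite /other; case: pickP => [w' /andP[w'u w'M]|none] /=.
    by apply/eqP/andP => [<- //|[wu wM]]; apply: Mu.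
  exfalso; move/bigcupP: uM => [e eM ue].
  have /eqP/cards2P[a [b [ab eE]]] : #|e| = 2.
    by apply: E2; have := MV; rewrite inE => /and3P[/subsetP ME _ _]; apply: ME.
  move: ab ue eM; rewrite eE !inE => ab /orP[]/eqP ua; rewrite -ua in ab * => m.
    by have := none b; rewrite m eq_sym ab.
  by have := none a; rewrite set2C m ab.
rewrite (partition_big other (mem (V :\ u))) /=; last first.
  move=> M /andP[MV uM]; have := otherP M (other M) MV uM.
  rewrite eqxx => /esym/andP[ou oM]; rewrite !inE ou /=.
  by apply: (subsetP (matching_edge_subset MV oM)); rewrite !inE eqxx orbT.
rewrite -sumrN; apply: eq_bigr => w; rewrite inE => /andP[]; rewrite inE => wu wV.
transitivity (\sum_(M in matchings E V | [set u; w] \in M)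
   (-1) ^+ #|M| * \prod_(v in V :\: cover M) x v).
  apply: eq_bigl => M; apply/andP/andP => [[/andP[MV uM]]|[MV eM]].
    by rewrite otherP // => /andP[].
  have uM : u \in cover M by apply/bigcupP; exists [set u; w]; rewrite // !inE eqxx.
  by rewrite otherP // MV uM wu.
have [eE|eE] := boolP ([set u; w] \in E).
  rewrite mul1r wmatch_with_edge ?setDDl //; last by rewrite -card_gt0 cards2.
  by rewrite subUset !sub1set uV.
rewrite mul0r oppr0 big_pred0 // => M; apply/negP => /andP[].
by rewrite inE => /and3P[/subsetP ME _ _] /ME; rewrite (negPf eE).
Qed.

(** The vertex recurrence is affine in the weight of [u], and its other terms do not involve that
    weight. *)
Lemma wmatch_shift E x V u y : (forall e, e \in E -> #|e| = 2) -> u \in V ->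
  wmatch E (fun v => if v == u then x v + y else x v) V
    = wmatch E x V + y * wmatch E x (V :\ u).
Proof.
move=> E2 uV; rewrite !(@wmatch_vertex E _ V u) // eqxx.
have sub (W : {set T}) : W \subset V :\ u ->
    wmatch E (fun v => if v == u then x v + y else x v) W = wmatch E x W.
  move=> /subsetP WV; apply: eq_wmatch => v /WV; rewrite !inE.
  by case: eqP.
rewrite sub // (eq_bigr _ (fun w _ => congr1 _ (sub _ (subD1set _ w)))); ring.
Qed.

(** Induction on [V1] through the vertex recurrence at some [u] in [V1]: all neighbours of [u] in
    the union lie in [V1], so the factor of [V2] comes out of every term. *)
Lemma wmatch_disjoint E x V V1 V2 : (forall e, e \in E -> #|e| = 2) ->
    V = V1 :|: V2 -> [disjoint V1 & V2] ->
    (forall u w, u \in V1 -> w \in V2 -> [set u; w] \notin E) ->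
  wmatch E x V = wmatch E x V1 * wmatch E x V2.
Proof.
move=> E2 ->; have [n] := ubnP #|V1|; elim: n V1 => // n IH V1 V1n dis E12.
have [->|/set0Pn[u u1]] := eqVneq V1 set0.
  rewrite set0U wmatch0 ?mul1r //; apply/negP => /E2.
  by rewrite cards0.
have u2 : u \notin V2.
  by apply/negP => u2; have := disjointFr dis u1; rewrite u2.
have IHW (W : {set T}) : W \subset V1 :\ u -> wmatch E x (W :|: V2) = wmatch E x W * wmatch E x V2.
  move=> W1; have W1' : W \subset V1 by apply: subset_trans W1 (subD1set _ _).
  apply: IH.
  - by apply: leq_ltn_trans (subset_leq_card W1) _; rewrite (cardsD1 u V1) u1 in V1n.
  - by apply: disjointWl dis.
  - by move=> a b /(subsetP W1'); apply: E12.
have D1U (W : {set T}) a : a \notin V2 -> (W :|: V2) :\ a = (W :\ a) :|: V2.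
  move=> a2; apply/setP => b; rewrite !inE; case: eqP => // ->.
  by rewrite (negPf a2).
rewrite (@wmatch_vertex E x _ u) ?inE ?u1 // (@wmatch_vertex E x V1 u) //.
rewrite D1U // IHW // mulrBl mulrA; congr (_ - _).
rewrite (big_setID V1) /= [X in _ + X]big1 ?addr0 => [|w]; last first.
  rewrite !inE => /andP[/negPf w1]; rewrite w1 /= andbF /= => w2.
  by rewrite (negPf (E12 _ _ u1 w2)) mul0r.
rewrite mulr_suml; apply: eq_big => [w|w].
  rewrite !inE; case w1 : (w \in V1); rewrite ?andbT ?andbF //= ?orbT ?orbF //.
  by rewrite (disjointFr dis w1) orbF.
rewrite !inE => /andP[_ w1]; rewrite D1U ?IHW ?subD1set ?mulrA //.
by rewrite (disjointFr dis w1).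
Qed.

End WeightedMatchings.

(** * The Christoffel-Darboux inequality *)

Lemma setD1C (T : finType) (V : {set T}) u v : V :\ u :\ v = V :\ v :\ u.
Proof. by rewrite !setDDl setUC. Qed.

(* The left-hand side of the Christoffel-Darboux identity of Heilmann and Lieb. *)
Definition cdiff (A : comNzRingType) (T : finType) (E : {set {set T}})
    (x : T -> A) (V : {set T}) (u v : T) : A :=
  wmatch E x (V :\ u) * wmatch E x (V :\ v)
    - wmatch E x V * wmatch E x (V :\ u :\ v).

Section ChristoffelDarboux.
Variables (T : finType) (E : {set {set T}}).
Hypothesis E2 : forall e, e \in E -> #|e| = 2.
Implicit Types (V : {set T}) (u v w : T).

(* Iterating this recursion sums squares over the paths from [u] to [v]. *)
Lemma cdiff_vertex (A : comNzRingType) (x : T -> A) V u v :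
    u \in V -> v \in V -> u != v ->
  cdiff E x V u v = ([set u; v] \in E)%:R * wmatch E x (V :\ u :\ v) ^+ 2
    + \sum_(w in V :\ u :\ v) ([set u; w] \in E)%:R * cdiff E x (V :\ u) w v.
Proof.
move=> uV vV uv.
have -> : \sum_(w in V :\ u :\ v) ([set u; w] \in E)%:R * cdiff E x (V :\ u) w v
   = (\sum_(w in V :\ u :\ v) ([set u; w] \in E)%:R * wmatch E x (V :\ u :\ w))
       * wmatch E x (V :\ u :\ v)
     - wmatch E x (V :\ u)
       * \sum_(w in V :\ u :\ v) ([set u; w] \in E)%:R * wmatch E x (V :\ u :\ v :\ w).
  rewrite mulr_suml mulr_sumr -sumrB; apply: eq_bigr => w _.
  by rewrite /cdiff (setD1C (V :\ u) w v); ring.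
rewrite /cdiff (wmatch_vertex x E2 uV) (@wmatch_vertex _ _ E x (V :\ v) u) //; last first.
  by rewrite !inE uv.
have vVu : v \in V :\ u by rewrite !inE eq_sym uv.
by rewrite (setD1C V v u) (big_setD1 v vVu) /=; ring.
Qed.

Variable R : realFieldType.
Implicit Type x : T -> R.

(** By induction the sum in [cdiff_vertex] is nonnegative, so the term of the direct edge is a lower
    bound. *)
Lemma cdiff_ge x V u v : u \in V -> v \in V -> u != v ->
  ([set u; v] \in E)%:R * wmatch E x (V :\ u :\ v) ^+ 2 <= cdiff E x V u v.
Proof.
have [n] := ubnP #|V|; elim: n V u v => // n IH V u v Vn uV vV uv.
rewrite cdiff_vertex // lerDl sumr_ge0 // => w.
rewrite !inE => /and3P[wv wu wV]; rewrite mulr_ge0 ?ler0n //.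
apply: le_trans (IH _ _ _ _ _ _ wv).
- by rewrite mulr_ge0 ?ler0n ?sqr_ge0.
- by rewrite (cardsD1 u V) uV in Vn.
- by rewrite !inE wu.
- by rewrite !inE eq_sym uv.
Qed.

Lemma cdiff_ge0 x V u v : u \in V -> v \in V -> u != v -> 0 <= cdiff E x V u v.
Proof.
move=> uV vV uv; apply: le_trans (cdiff_ge x uV vV uv).
by rewrite mulr_ge0 ?ler0n ?sqr_ge0.
Qed.

(* Shifting the weight of [v] by [y] makes [cdiff] a nonnegative quadratic
   polynomial in [y]; this is the nonpositivity of its discriminant. *)
Lemma cdiff_discriminant x V (M : {set T} -> R) u v w :
    (forall X, M X = wmatch E x (V :\: X)) -> u \in V -> v \in V -> w \in V ->
    u != v -> v != w -> u != w ->
  (M [set u] * M [set v; w] + M [set w] * M [set u; v]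
     - M set0 * M [set u; v; w] - M [set v] * M [set u; w]) ^+ 2
  <= 4 * cdiff E x V u w * cdiff E x (V :\ v) u w.
Proof.
move=> ME uV vV wV uv vw uw; apply: discriminant_le.
  by apply: cdiff_ge0; rewrite ?inE ?uv ?uV ?wV // eq_sym vw.
move=> y; have := cdiff_ge0 (fun z => if z == v then x z + y else x z) uV wV uw.
(* Each [wmatch] over a set containing [v] is affine in [y], with slope obtained by deleting [v];
   expanding the two products gives the three coefficients. *)
suff -> : cdiff E (fun z => if z == v then x z + y else x z) V u w =
  cdiff E x V u w + (M [set u] * M [set v; w] + M [set w] * M [set u; v]
     - M set0 * M [set u; v; w] - M [set v] * M [set u; w]) * y
   + cdiff E x (V :\ v) u w * y ^+ 2 by [].
rewrite /cdiff !wmatch_shift ?inE ?vV ?vw ?[v == u]eq_sym ?uv //.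
rewrite !ME setD0 -!setDDl ![V :\ u :\ v]setD1C ![V :\ w :\ v]setD1C.
by rewrite (setD1C (V :\ u) w v) (setD1C V u v); ring.
Qed.

End ChristoffelDarboux.

Notation matchpoly E V := (wmatch E (fun=> 'X) V).

Section MatchingPolynomial.
Variables (R : rcfType) (T : finType) (E : {set {set T}}).
Hypothesis E2 : forall e, e \in E -> #|e| = 2.
Implicit Types (V : {set T}) (u v w : T) (p q : {poly R}).

Lemma horner_matchpoly V t : (matchpoly E V).[t] = wmatch E (fun=> t : R) V.
Proof.
rewrite horner_sum; apply: eq_bigr => M _.
by rewrite hornerM horner_prod horner_exp hornerN hornerC; under eq_bigr do rewrite hornerX.
Qed.

(** A matching contributes a power of ['X] whose exponent counts the uncovered vertices.
    Differentiating chooses one of them, and the matching survives its deletion. *)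
Lemma deriv_matchpoly V : (matchpoly E V : {poly R})^`() = \sum_(v in V) matchpoly E (V :\ v).
Proof.
rewrite /wmatch raddf_sum /= (exchange_big_dep (mem (matchings E V))) /=; last first.
  move=> v M vV; rewrite !inE => /and3P[-> -> /subset_trans] -> //.
  exact: subD1set.
apply: eq_bigr => M MV; rewrite -signr_odd mulr_sign.
rewrite -mulr_sumr mulr_sign.
have dprod : (\prod_(v in V :\: cover M) 'X)^`()
    = \sum_(i in V | M \in matchings E (V :\ i)) \prod_(v in V :\ i :\: cover M) 'X :> {poly R}.
  rewrite prodr_const derivXn -sumr_const.
  apply: eq_big => [v|v].
    by move: MV; rewrite !inE subsetD1 => /and3P[-> -> ->] /=; rewrite andbC.
  move=> vV; rewrite prodr_const (cardsD1 v (V :\: _)) vV /=.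
  by congr ('X ^+ #|pred_of_set _|); rewrite !setDDl setUC.
by case: odd; rewrite ?derivN dprod.
Qed.

Lemma matchpoly_monic V : (matchpoly E V : {poly R}) \is monic.
Proof.
(* The size is part of the induction: it shows that the terms with two deleted vertices have lower
   degree than ['X * matchpoly E (V :\ u)]. *)
suff [/monicP] : lead_coef (matchpoly E V : {poly R}) = 1
  /\ size (matchpoly E V : {poly R}) = #|V|.+1 by [].
have [n] := ubnP #|V|; elim: n V => // n IH V Vn.
have [->|/set0Pn[u uV]] := eqVneq V set0.
  rewrite wmatch0 ?lead_coef1 ?size_poly1 ?cards0 //.
  by apply/negP => /E2; rewrite cards0.
rewrite (cardsD1 u V) uV add1n in Vn *.
have [l s] := IH (V :\ u) Vn; rewrite (wmatch_vertex _ E2 uV).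
have p0 : (matchpoly E (V :\ u) : {poly R}) != 0 by rewrite -size_poly_eq0 s.
have sX : size ('X * matchpoly E (V :\ u) : {poly R}) = #|V :\ u|.+2.
  by rewrite mulrC size_mulX // s.
pose rest : {poly R} := - \sum_(w in V :\ u) ([set u; w] \in E)%:R * matchpoly E (V :\ u :\ w).
pose main : {poly R} := 'X * matchpoly E (V :\ u).
have small : (size rest < size main)%N.
  rewrite sX size_polyN ltnS; apply: leq_trans (size_sum _ _ _) _.
  apply/bigmax_leqP => w wV; case: (_ \in E); rewrite ?mul0r ?size_poly0 // mul1r.
  have [|_ ->] := IH (V :\ u :\ w); last by rewrite ltnS subset_leq_card ?subD1set.
  by apply: leq_ltn_trans (Vn : (#|V :\ u| < n)%N); rewrite subset_leq_card ?subD1set.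
by rewrite -/main -/rest lead_coefDl // size_polyDl // lead_coefM lead_coefX mul1r.
Qed.

Lemma matchpoly_neq0 V : (matchpoly E V : {poly R}) != 0.
Proof. exact/monic_neq0/matchpoly_monic. Qed.

(** In the sum for the derivative the vertex [u] gives the square and every other vertex gives a
    [cdiff]. Hence the Wronskian is at least the square at every real point. *)
Lemma matchpoly_wronskian V u : u \in V ->
  (matchpoly E V)^`() * matchpoly E (V :\ u) - matchpoly E V * (matchpoly E (V :\ u))^`()
    = matchpoly E (V :\ u) ^+ 2
      + \sum_(v in V :\ u) cdiff E (fun=> 'X : {poly R}) V u v.
Proof.
move=> uV; rewrite !deriv_matchpoly (big_setD1 u) //= mulrDl -addrA -expr2; congr (_ + _).
rewrite mulr_suml mulr_sumr -sumrB; apply: eq_bigr => v _.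
by rewrite /cdiff mulrC.
Qed.

Lemma horner_cdiff V u v t :
  (cdiff E (fun=> 'X) V u v).[t] = cdiff E (fun=> t : R) V u v.
Proof. by rewrite /cdiff hornerD hornerN !hornerM !horner_matchpoly. Qed.

End MatchingPolynomial.

(** * Multiplicities *)

Definition multv (R : rcfType) (T : finType) (t : R) (E : {set {set T}})
    (V : {set T}) : nat := mup t (matchpoly E V).

Section Multiplicity.
Variables (R : rcfType) (t : R) (T : finType) (E : {set {set T}}).
Hypothesis E2 : forall e, e \in E -> #|e| = 2.
Implicit Types (V W : {set T}) (u v w : T).
Local Notation m := (multv t E).
Local Notation P := ('X - t%:P).

Lemma multv_geq n V : (n <= m V)%N = (P ^+ n %| matchpoly E V).
Proof. by rewrite /multv mup_geq // matchpoly_neq0. Qed.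

Lemma multv_gt0 V : (0 < m V)%N = (wmatch E (fun=> t) V == 0).
Proof. by rewrite multv_geq expr1 dvdp_XsubCl rootE horner_matchpoly. Qed.

Lemma dvdp_exp_mul a b n (p q : {poly R}) :
  (n <= a + b)%N -> P ^+ a %| p -> P ^+ b %| q -> P ^+ n %| p * q.
Proof.
move=> nab pa qb; apply: dvdp_trans (dvdp_mul pa qb).
by rewrite -exprD dvdp_exp2l.
Qed.

Lemma dvdp_matchpolyM n V W : (n <= m V + m W)%N -> P ^+ n %| matchpoly E V * matchpoly E W.
Proof. by move/dvdp_exp_mul; apply; rewrite -multv_geq. Qed.

Lemma dvdp_cdiff n V u v :
    (n <= m (V :\ u) + m (V :\ v))%N -> (n <= m V + m (V :\ u :\ v))%N ->
  P ^+ n %| cdiff E (fun=> 'X) V u v.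
Proof. by move=> h1 h2; rewrite dvdp_sub ?dvdp_matchpolyM. Qed.

(** With [k = m (V :\ u)], a larger [m V] would make the Wronskian vanish to order [2k + 1]. It
    dominates the square of [matchpoly E (V :\ u)], which would then vanish to order [k + 1]. *)
Lemma multv_del_geq V u : (m V <= (m (V :\ u)).+1)%N.
Proof.
have [uV|uV] := boolP (u \in V); last first.
  by have /setDidPl -> : [disjoint V & [set u]] by rewrite disjoint_sym disjoints1.
rewrite leqNgt; apply/negP => lt.
suff : (m (V :\ u) < m (V :\ u))%N by rewrite ltnn.
rewrite multv_geq; apply: (@sqr_le_root_order _ _
  (matchpoly E (V :\ u) ^+ 2 + \sum_(v in V :\ u) cdiff E (fun=> 'X : {poly R}) V u v)).
  move=> x; rewrite hornerD horner_exp lerDl horner_sum sumr_ge0 // => v.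
  by rewrite !inE => /andP[vu vV]; rewrite horner_cdiff cdiff_ge0 // eq_sym.
rewrite -matchpoly_wronskian //; have : (m (V :\ u) <= m (V :\ u))%N by [].
move: lt; rewrite !multv_geq => dV du; apply: dvdp_sub.
  by apply: dvdp_exp_mul (dvdp_deriv_XsubC_exp dV) du; lia.
by apply: dvdp_exp_mul dV (dvdp_deriv_XsubC_exp du); lia.
Qed.

(** By [multv_del_geq] on [V :\ u], every term of the vertex recurrence at [u] vanishes to order at
    least [m (V :\ u) - 1]. *)
Lemma multv_del_leq V u : (m (V :\ u) <= (m V).+1)%N.
Proof.
have [uV|uV] := boolP (u \in V); last first.
  by have /setDidPl -> : [disjoint V & [set u]] by rewrite disjoint_sym disjoints1.
case mu : (m (V :\ u)) => [//|k]; rewrite ltnS multv_geq (wmatch_vertex _ E2 uV).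
rewrite dvdp_sub ?dvdp_mull -?multv_geq ?mu //.
apply: (big_ind (fun p : {poly R} => P ^+ k %| p)) => [||w _]; first exact: dvdp0.
  by move=> p q; apply: dvdp_add.
by rewrite dvdp_mull // -multv_geq -ltnS -mu multv_del_geq.
Qed.

Lemma multv_setD_leq V W : (m (V :\: W) <= m V + #|W|)%N.
Proof.
have [n] := ubnP #|W|; elim: n W => // n IH W; have [->|/set0Pn[w wW]] := eqVneq W set0.
  by rewrite setD0 leq_addr.
rewrite (cardsD1 w W) wW add1n ltnS => /IH le; rewrite addnS.
apply: leq_trans (_ : _ <= (m (V :\: (W :\ w))).+1)%N _; last by rewrite ltnS.
by have := multv_del_leq (V :\: (W :\ w)) w; rewrite setDDl setUC setD1K.
Qed.

Lemma edge_neq u v : [set u; v] \in E -> u != v.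
Proof. by move/E2; rewrite cards2; case: eqP. Qed.

Lemma horner_edge_cdiff V u v x : u \in V -> v \in V -> [set u; v] \in E ->
  (matchpoly E (V :\ u :\ v)).[x] ^+ 2 <= (cdiff E (fun=> 'X : {poly R}) V u v).[x].
Proof.
move=> uV vV e; rewrite horner_cdiff horner_matchpoly.
by have := cdiff_ge E2 (fun=> x) uV vV (edge_neq e); rewrite e mul1r.
Qed.

(** With [k = m (V :\ u :\ v)] and [m V >= k + 2], interlacing makes [cdiff] vanish to order
    [2k + 1]. Along an edge it dominates the square of [matchpoly E (V :\ u :\ v)], whose root would
    have order above [k]. *)
Lemma multv_edge V u v : u \in V -> v \in V -> [set u; v] \in E ->
  (m V <= (m (V :\ u :\ v)).+1)%N.
Proof.
move=> uV vV e; rewrite leqNgt; apply/negP => lt.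
have : (m (V :\ u :\ v) < m (V :\ u :\ v))%N; last by rewrite ltnn.
rewrite multv_geq; apply: sqr_le_root_order (fun x => horner_edge_cdiff x uV vV e) _.
have := multv_del_geq V u; have := multv_del_geq V v => h1 h2.
by apply: dvdp_cdiff; lia.
Qed.

Lemma cdiff_order_even n V u v : u \in V -> v \in V -> u != v ->
  P ^+ n.*2.+1 %| cdiff E (fun=> 'X) V u v -> P ^+ n.*2.+2 %| cdiff E (fun=> 'X) V u v.
Proof.
by move=> uV vV uv; apply: nneg_root_order_even => x; rewrite horner_cdiff cdiff_ge0.
Qed.

Lemma multvM V W n : (P ^+ n %| matchpoly E V * matchpoly E W) = (n <= m V + m W)%N.
Proof. by rewrite -mupM ?matchpoly_neq0 // mup_geq // mulf_neq0 // matchpoly_neq0. Qed.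

(** [cdiff] vanishes at [t], hence to order two by nonnegativity. So does the product for [V :\ u]
    and [V :\ v], which leaves order two for [V :\ u :\ v], as [V] contributes none. *)
Lemma multv_pair_even V u v : u \in V -> v \in V -> u != v -> m V = 0 ->
    (0 < m (V :\ u))%N -> (0 < m (V :\ v))%N -> (0 < m (V :\ u :\ v))%N ->
  (1 < m (V :\ u :\ v))%N.
Proof.
move=> uV vV uv V0 u0 v0 uv0.
have := @cdiff_order_even 0 _ _ _ uV vV uv; rewrite dvdp_cdiff; try lia.
by move=> /(_ isT); rewrite dvdp_subr multvM; lia.
Qed.

(** Put [k = m (V :\ u)]. If [m (V :\ v) = m V = k + 1], then [cdiff] vanishes to order [2k + 1],
    hence to order [2k + 2] by parity, and the edge bound gives [m (V :\ u :\ v) > k]. Both [cdiff]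
    and its second product then have order at least [2k + 2], but the first product has order
    exactly [2k + 1]. *)
Lemma essential_nbr V u v : u \in V -> v \in V -> [set u; v] \in E ->
  m V = (m (V :\ u)).+1 -> m (V :\ v) <> m V.
Proof.
move=> uV vV e uE vE; have := multv_edge uV vV e => le.
have d1 : P ^+ (m (V :\ u)).*2.+1 %| cdiff E (fun=> 'X) V u v.
  by apply: dvdp_cdiff; lia.
have : (m (V :\ u) < m (V :\ u :\ v))%N.
  by rewrite multv_geq; apply: sqr_le_root_order d1 => x; apply: horner_edge_cdiff.
move=> lt; have := cdiff_order_even uV vV (edge_neq e) d1.
by rewrite dvdp_subl ?multvM; lia.
Qed.

(** As [u] is essential, the bound on [m (V :\ u :\ v)] says that [v] is not essential in [V :\ u].
    If the conclusion fails, then [m V = j + 2], each single deletion leaves [j + 1], and one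
    product in the discriminant inequality has too low an order. *)
Lemma essential_trans V u v w : u \in V -> v \in V -> w \in V ->
    u != v -> v != w -> u != w ->
    m V = (m (V :\ u)).+1 -> m V = (m (V :\ v)).+1 -> m V = (m (V :\ w)).+1 ->
    (m V <= (m (V :\ u :\ v)).+1)%N -> (m V <= (m (V :\ v :\ w)).+1)%N ->
  (m V <= (m (V :\ u :\ w)).+1)%N.
Proof.
move=> uV vV wV uv vw uw uE vE wE le1 le2; rewrite leqNgt; apply/negP => lt.
set j := m (V :\ u :\ w) in lt *.
have le3 : (j.+1 <= m (V :\ u))%N by lia.
have le4 : (m (V :\ u) <= j.+1)%N by apply: multv_del_geq.
have le5 := multv_del_geq (V :\ u :\ v) w.
pose M X : {poly R} := matchpoly E (V :\: X).
pose q := M [set u] * M [set v; w] + M [set w] * M [set u; v]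
     - M set0 * M [set u; v; w] - M [set v] * M [set u; w].
have qP x : q.[x] ^+ 2
    <= (4%:P * cdiff E (fun=> 'X) V u w * cdiff E (fun=> 'X) (V :\ v) u w).[x].
  rewrite !hornerM hornerC !horner_cdiff.
  have ME X : (M X).[x] = wmatch E (fun=> x) (V :\: X) by apply: horner_matchpoly.
  have := cdiff_discriminant E2 ME uV vV wV uv vw uw.
  by rewrite -!hornerM -!(hornerN, hornerD) .
(* The two [cdiff] factors vanish to orders [2j + 2] and [2j + 1], so [q ^+ 2] is bounded by a
   polynomial of order at least [4j + 3]. *)
have qdvd : P ^+ (j.*2.+1).+1 %| q.
  apply: sqr_le_root_order qP _; rewrite -mulrA dvdp_mull //.
  apply: (@dvdp_exp_mul (j.*2.+2) (j.*2.+1)); first by lia.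
    by apply: dvdp_cdiff; lia.
  apply: dvdp_cdiff; rewrite (setD1C V v u); first by rewrite -/j; lia.
  by rewrite (setD1C (V :\ u) v w) -/j in le5 *; lia.
(* The first three products of [q] have order at least [2j + 2], while [M [set v] * M [set u; w]]
   has order exactly [2j + 1]. *)
move: qdvd; rewrite dvdp_subr; last first.
  rewrite /M setD0 -!setDDl; apply: dvdp_sub; first apply: dvdp_add; apply: dvdp_matchpolyM; lia.
rewrite /M -!setDDl multvM -/j; lia.
Qed.

Lemma multv_disjoint V V1 V2 : V = V1 :|: V2 -> [disjoint V1 & V2] ->
    (forall u w, u \in V1 -> w \in V2 -> [set u; w] \notin E) ->
  m V = (m V1 + m V2)%N.
Proof.
move=> VE dis E12.
by rewrite /multv (wmatch_disjoint _ E2 VE dis E12) mupM ?matchpoly_neq0.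
Qed.

(** Otherwise every summand of the derivative vanishes to order [m V], which forces a root of order
    [m V + 1]. *)
Lemma essential_exists V : (0 < m V)%N -> exists2 u, u \in V & m V = (m (V :\ u)).+1.
Proof.
move=> V0; have [/exists_inP[u uV lt]|/exists_inPn none] :=
  boolP [exists u in V, m (V :\ u) < m V]%N.
  by exists u => //; apply/eqP; rewrite eqn_leq lt multv_del_geq.
have : (m V < m V)%N; last by rewrite ltnn.
rewrite multv_geq dvdp_XsubC_expS -?multv_geq // deriv_matchpoly.
apply: (big_ind (fun p : {poly R} => P ^+ m V %| p)) => [||u uV]; first exact: dvdp0.
  by move=> p q; apply: dvdp_add.
by rewrite -multv_geq leqNgt none.
Qed.

End Multiplicity.

(** * Gallai's lemma *)

(** Connectedness as an induction principle: a property that spreads along the edges inside [C]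
    holds on all of [C] once it holds somewhere in [C]. *)
Definition connected_in (T : finType) (E : {set {set T}}) (C : {set T}) : Prop :=
  forall Q : {set T},
    (forall x y, x \in C -> y \in C -> [set x; y] \in E -> x \in Q -> y \in Q) ->
  forall x y, x \in C -> y \in C -> x \in Q -> y \in Q.

(** Deleting one vertex raises the multiplicity by at most one, so [0 <] already means multiplicity
    one. *)
Definition superpositive_on (R : rcfType) (T : finType) (t : R)
    (E : {set {set T}}) (V : {set T}) : Prop :=
  multv t E V = 0 /\ forall u, u \in V -> (0 < multv t E (V :\ u))%N.

Section Gallai.
Variables (R : rcfType) (t : R) (T : finType) (E : {set {set T}}).
Hypothesis E2 : forall e, e \in E -> #|e| = 2.
Variable C : {set T}.
Hypothesis C_conn : connected_in E C.
Local Notation m := (multv t E).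

Lemma all_essential_simple : (0 < m C)%N ->
  (forall u, u \in C -> m C = (m (C :\ u)).+1) -> m C = 1.
Proof.
move=> C0 ess; have [u uC uE] := essential_exists E2 C0.
(* Besides [u] itself, these are the vertices not essential in [C :\ u]. Edges satisfy this relation
   by [multv_edge], and [essential_trans] spreads it through [C]. *)
pose Q := [set v | (v == u) || (m C <= (m (C :\ u :\ v)).+1)%N].
have allQ v : v \in C -> v \in Q.
  move=> vC; apply: (@C_conn Q _ u v) => //; last by rewrite inE eqxx.
  move=> x y xC yC xyE; rewrite !inE; have [//|yu] := eqVneq y u.
  have [xu _|xu le] := eqVneq x u => /=; first by rewrite -xu multv_edge.
  apply: (@essential_trans _ t _ _ E2 C u x y) => //; try exact: ess.
  - by rewrite eq_sym.
  - exact: (edge_neq E2 xyE).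
  - by rewrite eq_sym.
  - exact: multv_edge.
apply/eqP; rewrite eqn_leq C0 andbT leqNgt; apply/negP => C1.
(* Multiplicity at least two would leave a root for [C :\ u], hence an essential vertex of [C :\ u],
   which [allQ] excludes. *)
have [|w] := @essential_exists _ t _ _ E2 (C :\ u); first by lia.
rewrite inE => /andP[]; rewrite inE => wu wC wE.
by have := allQ w wC; rewrite inE (negPf wu) /=; lia.
Qed.

Lemma no_positive_connected : (forall u, u \in C -> (m (C :\ u) <= m C)%N) ->
  (0 < m C)%N -> m C = 1 /\ forall u, u \in C -> m C = (m (C :\ u)).+1.
Proof.
move=> npos C0; suff ess : forall u, u \in C -> m C = (m (C :\ u)).+1.
  by split=> //; apply: all_essential_simple.
have [u uC uE] := essential_exists E2 C0.
move=> v vC; pose Q := [set x | m C == (m (C :\ x)).+1].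
suff : v \in Q by rewrite inE => /eqP.
apply: (@C_conn Q _ u v) => //; last by rewrite inE; apply/eqP.
move=> x y xC yC xyE; rewrite !inE => /eqP xess; have := essential_nbr E2 xC yC xyE xess.
move=> ne; apply/eqP.
have := npos y yC; have := multv_del_geq t E2 C y; lia.
Qed.

End Gallai.

(** * Deleting extreme edges *)

Section DeleteExtremeEdges.
Variables (R : rcfType) (t : R) (T : finType).
Implicit Types (E Z : {set {set T}}) (V W e f : {set T}).

(** In the edge recurrence the values at [t] for [E] and [E :\ e] differ by the value for [W :\: e],
    which vanishes; an edge not inside [W] does not matter. *)
Lemma multv_gt0_del_edge E W e : (forall e, e \in E -> #|e| = 2) -> e \in E ->
    (e \subset W -> (0 < multv t E (W :\: e))%N) ->
  (0 < multv t (E :\ e) W)%N = (0 < multv t E W)%N.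
Proof.
move=> E2 eE; rewrite !multv_gt0 //; last by move=> f /setD1P[_ /E2].
have [eW /(_ isT)/eqP We|eW _] := boolP (e \subset W).
  rewrite (wmatch_del_edge _ eE eW) ?We ?subr0 //.
  by rewrite -card_gt0 E2.
rewrite (@eq_wmatch_edges _ _ _ E) // => f fW; rewrite !inE.
by case: eqP => // fe; rewrite -fe fW in eW.
Qed.

(** The second conclusion tracks only whether [t] is a root, since for a super positive graph this
    already decides which edges are extreme. *)
Lemma superpositive_del_edge E V e : (forall e, e \in E -> #|e| = 2) ->
    superpositive_on t E V -> e \in E -> e \subset V ->
    (0 < multv t E (V :\: e))%N ->
  superpositive_on t (E :\ e) V /\
  forall f, f \in E -> f \subset V ->
    (0 < multv t (E :\ e) (V :\: f))%N = (0 < multv t E (V :\: f))%N.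
Proof.
move=> E2 [V0 Vu] eE eV Ve.
have {}Ve : (1 < multv t E (V :\: e))%N.
  have /eqP/cards2P[a [b [ab e_E]]] := E2 _ eE.
  move: eE eV Ve; rewrite e_E -setDDl subUset !sub1set => eE /andP[aV bV] Ve.
  by apply: multv_pair_even => //; apply: Vu.
split; first split.
- apply/eqP; rewrite eqn0Ngt multv_gt0_del_edge ?V0 //; lia.
- move=> u uV; rewrite multv_gt0_del_edge ?Vu // => _.
  have := multv_del_geq t E2 (V :\: e) u.
  by rewrite !setDDl setUC; lia.
- move=> f fE fV; apply: multv_gt0_del_edge => //.
  have /eqP/cards2P[a [b [ab f_E]]] := E2 _ fE.
  rewrite subsetD => /andP[_ dis].
  have fVe : f \subset V :\: e by rewrite subsetD fV disjoint_sym.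
  move: fVe; rewrite f_E subUset !sub1set => /andP[aV bV].
  have := multv_edge t E2 aV bV; rewrite -f_E => /(_ fE).
  by rewrite !setDDl -f_E [f :|: e]setUC; lia.
Qed.

Lemma superpositive_del_edges E V Z : (forall e, e \in E -> #|e| = 2) ->
    superpositive_on t E V -> Z \subset E ->
    (forall e, e \in Z -> e \subset V /\ (0 < multv t E (V :\: e))%N) ->
  superpositive_on t (E :\: Z) V /\
  forall f, f \in E :\: Z -> f \subset V ->
    (0 < multv t (E :\: Z) (V :\: f))%N = (0 < multv t E (V :\: f))%N.
Proof.
have [n] := ubnP #|Z|; elim: n E Z => // n IH E Z Zn E2 sp ZE Zext.
have [->|/set0Pn[e eZ]] := eqVneq Z set0; first by rewrite setD0.
have [eV Ve] := Zext e eZ; have eE := subsetP ZE e eZ.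
have [sp1 ext1] := superpositive_del_edge E2 sp eE eV Ve.
have EZ : E :\ e :\: (Z :\ e) = E :\: Z by rewrite setDDl setD1K.
have [||||sp2 ext2] := IH (E :\ e) (Z :\ e) _ _ sp1.
- by rewrite (cardsD1 e Z) eZ in Zn.
- by move=> f /setD1P[_ /E2].
- exact: setSD.
- move=> f /setD1P[_ fZ]; have [fV Vf] := Zext f fZ.
  by rewrite ext1 // (subsetP ZE).
rewrite EZ in sp2 ext2; split=> // f fEZ fV.
by rewrite ext2 // ext1 //; case/setDP: fEZ.
Qed.

End DeleteExtremeEdges.

(** * Graphs and their components *)

Section GraphMultiplicity.
Variables (R : rcfType) (t : R) (T : finType).
Implicit Types (G H : sgraph T) (X C : {set T}) (Z M : {set {set T}}) (e : {set T}).

Lemma edge_card G e : e \in edges G -> #|e| = 2.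
Proof. by move=> eG; have /andP[_ /eqP] := forall_inP (sgraph_wf G) e eG. Qed.

Lemma edge_sub G e : e \in edges G -> e \subset vertices G.
Proof. by move=> eG; have /andP[] := forall_inP (sgraph_wf G) e eG. Qed.

Lemma cover_matching_card (E M : {set {set T}}) V : (forall e, e \in E -> #|e| = 2) ->
  M \in matchings E V -> #|cover M| = (2 * #|M|)%N.
Proof.
move=> E2; rewrite inE => /and3P[/subsetP ME tM _].
rewrite -(eqP tM) mulnC -sum_nat_const; apply: eq_bigr => e /ME; exact: E2.
Qed.

Lemma matching_polyE G :
  matching_poly R G = wmatch (edges G) (fun=> 'X) (vertices G).
Proof.
have mE M : M \in matchings (edges G) (vertices G) -> (#|M| < (#|vertices G|./2).+1)%N.
  move=> MG; have := cover_matching_card (@edge_card G) MG.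
  have : (#|cover M| <= #|vertices G|)%N.
    by apply: subset_leq_card; move: MG; rewrite inE => /and3P[].
  by rewrite ltnS; lia.
rewrite /matching_poly /wmatch.
(* Matchings are grouped by size. [inord] never takes its default value, because a matching covers
   twice as many vertices as it has edges. *)
rewrite (partition_big (fun M => inord #|M| : 'I_(#|vertices G|./2).+1) predT) //=.
apply: eq_bigr => r _; rewrite /num_matchings.
transitivity (\sum_(M in matchings (edges G) (vertices G) | inord #|M| == r)
   ((-1) ^+ r *: 'X^(#|vertices G| - 2 * r) : {poly R})).
  rewrite sumr_const mulr_natr -scalerMnl; congr (_ *+ _).
  apply: eq_card => M; rewrite !inE unfold_in /= inE.
  have [ME|] := boolP (M \subset edges G) => //=.
  have [tM|] := boolP (trivIset M) => //=.
  have cM : cover M \subset vertices G.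
    by apply/bigcupsP => e /(subsetP ME); apply: edge_sub.
  rewrite cM /= -val_eqE /= inordK //; apply: mE.
  by rewrite inE ME tM.
apply: eq_bigr => M /andP[MG /eqP <-].
rewrite inordK ?mE // prodr_const cardsD.
have /setIidPr -> : cover M \subset vertices G by move: MG; rewrite inE => /and3P[].
by rewrite (cover_matching_card (@edge_card G) MG) -mul_polyC rmorphXn rmorphN1.
Qed.

Lemma mult_multv G : mult t G = multv t (edges G) (vertices G).
Proof. by rewrite /mult matching_polyE. Qed.

(** Edges leaving the vertex set occur in no matching, so all induced subgraphs can share the edge
    set of [G]. *)
Lemma mult_induced G X : mult t (induced G X) = multv t (edges G) (vertices G :&: X).
Proof.
rewrite mult_multv /multv; congr mup; apply: eq_wmatch_edges => e.
by rewrite subsetI inE => /andP[_ ->]; rewrite andbT.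
Qed.

Lemma mult_del_vertices G X :
  mult t (del_vertices G X) = multv t (edges G) (vertices G :\: X).
Proof. by rewrite mult_induced setDE. Qed.

Lemma induced_induced G X X' : induced (induced G X) X' = induced G (X :&: X').
Proof.
apply: val_inj => /=; congr pair; rewrite /vertices /edges /=.
  by rewrite setIA.
by apply/setP => e; rewrite !inE subsetI andbA.
Qed.

Lemma del_vertices_del G X X' :
  del_vertices (del_vertices G X) X' = del_vertices G (X :|: X').
Proof. by rewrite /del_vertices induced_induced setCU. Qed.

Lemma mult_induced_del_vertices G C X : C \subset vertices G ->
  mult t (del_vertices (induced G C) X) = multv t (edges G) (C :\: X).
Proof.
move=> CG; rewrite /del_vertices induced_induced mult_induced -setDE.
by congr multv; apply/setIidPr; apply: subset_trans CG; apply: subsetDl.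
Qed.

Lemma super_positiveP G :
  super_positive t G <-> superpositive_on t (edges G) (vertices G).
Proof.
rewrite /super_positive /superpositive_on -(mult_multv G); split.
  move=> /andP[/eqP G0 /forall_inP pos]; split=> // u /pos.
  by rewrite /positive mult_del_vertices => /eqP->.
move=> [G0 pos]; rewrite G0 eqxx; apply/forall_inP => u uG.
have := multv_del_leq t (@edge_card G) (vertices G) u.
by rewrite /positive mult_del_vertices -mult_multv G0; have := pos u uG; lia.
Qed.

(** Extremeness requires multiplicity two after deleting [e]: this is the largest possible value,
    and any positive value is at least two by [multv_pair_even]. *)
Lemma mem_extreme_edges G e : super_positive t G -> e \in edges G ->
  (e \in extreme_edges t G) = (0 < multv t (edges G) (vertices G :\: e))%N.
Proof.
move=> /super_positiveP[G0 pos] eG; rewrite inE eG /= /extreme_set edge_sub //=.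
rewrite (mult_multv G) mult_del_vertices G0 (edge_card eG).
have := multv_setD_leq t (@edge_card G) (vertices G) e.
rewrite G0 (edge_card eG).
have /eqP/cards2P[u [v [uv eE]]] := edge_card eG.
have := edge_sub eG; rewrite eE subUset !sub1set => /andP[uG vG].
have := multv_pair_even (@edge_card G) uG vG uv G0 (pos u uG) (pos v vG).
by rewrite setDDl; lia.
Qed.

End GraphMultiplicity.

(** * Connected components and disjoint unions *)

Section Blocks.
Variable (T : finType).
Implicit Types (G H : sgraph T) (X C D : {set T}) (x y : T).

Definition blocks G : {set {set T}} :=
  equivalence_partition (connect (adj G)) (vertices G).

Lemma adj_sym G : symmetric (adj G).
Proof. by move=> x y; rewrite /adj set2C. Qed.

Lemma adj_vertices G x y : adj G x y -> x \in vertices G /\ y \in vertices G.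
Proof. by move=> /edge_sub; rewrite subUset !sub1set => /andP[]. Qed.

Lemma adj_equiv G : {in vertices G & &, equivalence_rel (connect (adj G))}.
Proof.
move=> x y z _ _ _; split=> [|xy]; first exact: connect0.
exact: (same_connect (sym_connect_sym (@adj_sym G)) xy).
Qed.

Lemma blocks_partition G : partition (blocks G) (vertices G).
Proof. exact/equivalence_partitionP/adj_equiv. Qed.

(** These are the unions of vertex sets of components; both blocks and the parts of a disjoint union
    are of this kind. *)
Definition closed_in G C : Prop :=
  C \subset vertices G /\ forall x y, x \in C -> adj G x y -> y \in C.

Lemma closed_in_connect G C x y : closed_in G C -> x \in C ->
  connect (adj G) x y -> y \in C.
Proof.
move=> [_ Cc] xC xy; suff <- : (x \in C) = (y \in C) by [].
apply: (closed_connect _ xy) => a b ab; apply/idP/idP => [/Cc|/Cc]; apply=> //.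
by rewrite adj_sym.
Qed.

Lemma blockP G C : C \in blocks G <->
  [/\ closed_in G C, C != set0 & {in C &, forall x y, connect (adj G) x y}].
Proof.
have csym := sym_connect_sym (@adj_sym G).
split.
  move=> /imsetP[x xG ->]; split.
  - split=> [|y z]; first by apply/subsetP => y; rewrite inE => /andP[].
    rewrite !inE => /andP[yG xy] yz; rewrite (adj_vertices yz).2 /=.
    exact: connect_trans xy (connect1 yz).
  - by apply/set0Pn; exists x; rewrite inE xG connect0.
  - move=> y z; rewrite !inE => /andP[_ xy] /andP[_ xz].
    by apply: connect_trans xz; rewrite csym.
move=> [Cc /set0Pn[x xC] conn]; have [CG _] := Cc.
apply/imsetP; exists x; first exact: (subsetP CG).
apply/setP => y; rewrite inE; apply/idP/andP => [yC|[_]].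
  by rewrite (subsetP CG) // conn.
exact: closed_in_connect.
Qed.

Lemma block_connected_in G C : C \in blocks G -> connected_in (edges G) C.
Proof.
move=> /blockP[Cc _ conn] Q Qc x y xC yC xQ.
(* The intersection is closed under adjacency, so it contains whatever is reachable from [x]. *)
suff : y \in C :&: Q by rewrite inE => /andP[].
apply: (@closed_in_connect G _ x); last exact: conn.
  split=> [|a b]; first by apply: subset_trans Cc.1; apply: subsetIl.
  rewrite !inE => /andP[aC aQ] ab; have bC := Cc.2 _ _ aC ab.
  by rewrite bC (Qc a b).
by rewrite inE xC.
Qed.

Lemma block_uniq G C D x : C \in blocks G -> D \in blocks G -> x \in C -> x \in D -> C = D.
Proof.
move=> CG DG xC xD; have tP := partition_trivIset (blocks_partition G).
by rewrite -(def_pblock tP CG xC) -(def_pblock tP DG xD).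
Qed.

Lemma block_exists G x : x \in vertices G -> exists2 C, C \in blocks G & x \in C.
Proof. by rewrite -(cover_partition (blocks_partition G)) => /bigcupP[C]; exists C. Qed.

Lemma block_sub G C : C \in blocks G -> C \subset vertices G.
Proof. exact: partitionS (blocks_partition G). Qed.

Lemma vertices_induced G X : X \subset vertices G -> vertices (induced G X) = X.
Proof. by move/setIidPr. Qed.

Lemma componentsP G H :
  H \in components G <-> exists2 C, C \in blocks G & H = induced G C.
Proof. by split=> [/imsetP|] [C CG HE]; [exists C | apply/imsetP; exists C]. Qed.

Lemma closed_in_disjoint G C u w : closed_in G C ->
  u \in C -> w \notin C -> [set u; w] \notin edges G.
Proof. by move=> [_ Cc] uC; apply: contraNN => /(Cc _ _ uC). Qed.

Lemma components_disjoint_union G : is_disjoint_union G (components G).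
Proof.
split.
- move=> _ _ /imsetP[C CG ->] /imsetP[D DG ->] ne.
  rewrite !vertices_induced ?block_sub //.
  have /trivIsetP := partition_trivIset (blocks_partition G); apply=> //.
  by apply: contraNneq ne => ->.
- apply/setP => x; apply/idP/bigcupP => [|[H /componentsP[C CG ->]]]; last first.
    by rewrite vertices_induced ?block_sub //; apply/subsetP/block_sub.
  move=> /block_exists[C CG xC]; exists (induced G C); first exact: imset_f.
  by rewrite vertices_induced ?block_sub.
- apply/setP => e; apply/idP/bigcupP => [eG|[H /componentsP[C CG ->]]]; last first.
    by rewrite inE => /andP[].
  have /eqP/cards2P[u [v [uv eE]]] := edge_card eG.
  have := edge_sub eG; rewrite eE subUset !sub1set => /andP[uG vG].
  have [C CG uC] := block_exists uG; exists (induced G C); first exact: imset_f.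
  have /blockP[[_ Cc] _ _] := CG; rewrite inE -eE eG /= eE subUset !sub1set uC.
  by apply: Cc uC _; rewrite /adj -eE.
Qed.

Lemma connected_graphP G : connected_graph G <->
  vertices G != set0 /\ {in vertices G &, forall x y, connect (adj G) x y}.
Proof.
have cE : #|components G| = #|blocks G|.
  rewrite card_in_imset // => C D CG DG eq_ind.
  by rewrite -(vertices_induced (block_sub CG)) eq_ind vertices_induced ?block_sub.
have bG := cover_partition (blocks_partition G).
rewrite /connected_graph cE; split=> [/cards1P[C bE]|[V0 conn]].
  have /blockP[_ C0 Cconn] : C \in blocks G by rewrite bE set11.
  by rewrite -bG bE cover1.
have VG : vertices G \in blocks G.
  by apply/blockP; split=> //; split=> // x y _ /adj_vertices[].
apply/cards1P; exists (vertices G); apply/setP => C; rewrite inE.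
apply/idP/eqP => [CG|->] //; have /blockP[_ /set0Pn[x xC] _] := CG.
exact: block_uniq CG VG xC (subsetP (block_sub CG) x xC).
Qed.

Lemma component_connected G H : H \in components G -> connected_graph H.
Proof.
move=> /componentsP[C CG ->]; apply/connected_graphP.
have /blockP[Cc C0 _] := CG; rewrite vertices_induced ?block_sub //; split=> // x y xC yC.
(* Reachability in [G] is turned into reachability in the induced graph by taking for [Q] the set
   reachable from [x] there. *)
have := block_connected_in CG (Q := [set z | connect (adj (induced G C)) x z]) _ xC yC.
rewrite !inE connect0; apply=> // a b aC bC ab; rewrite !inE => /connect_trans; apply.
by apply: connect1; rewrite /adj inE ab subUset !sub1set aC.
Qed.

Lemma disjoint_union_part G (F : {set sgraph T}) H : is_disjoint_union G F -> H \in F ->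
  closed_in G (vertices H) /\ H = induced G (vertices H).
Proof.
move=> [dis VG EG] HF; have HG : vertices H \subset vertices G.
  by rewrite VG; apply: (bigcup_sup H).
(* An edge of [G] belongs to some part [K]; if it meets [H], disjointness forces [K = H]. *)
have edgeH e x : e \in edges G -> x \in e -> x \in vertices H -> e \in edges H.
  rewrite EG => /bigcupP[K KF eK] xe xH.
  have [-> //|ne] := eqVneq H K; have := disjointFr (dis H K HF KF ne) xH.
  by rewrite (subsetP (edge_sub eK)).
split.
  split=> // x y xH xy; have := edgeH _ x xy; rewrite !inE eqxx => /(_ isT xH)/edge_sub.
  by rewrite subUset !sub1set => /andP[].
apply: val_inj; rewrite /= (setIidPr HG); case Hval : (val H) => [VH EH].
have -> : VH = vertices H by rewrite /vertices Hval.
have -> : EH = edges H by rewrite /edges Hval.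
congr pair; apply/setP => e; rewrite inE; apply/idP/andP => [eH|[eG eH]].
  by rewrite edge_sub // EG; split=> //; apply/bigcupP; exists H.
have /set0Pn[x xe] : e != set0 by rewrite -card_gt0 (edge_card eG).
exact: edgeH eG xe (subsetP eH x xe).
Qed.

(** A connected part is a nonempty closed set with all its vertices linked, hence a block; since the
    parts cover [G], every block arises. *)
Lemma connected_disjoint_union_uniq G (F : {set sgraph T}) : is_disjoint_union G F ->
  {in F, forall H, connected_graph H} -> F = components G.
Proof.
move=> GF Fconn.
have FG H : H \in F -> vertices H \in blocks G.
  move=> HF; have [Hc HE] := disjoint_union_part GF HF.
  have /connected_graphP[H0 conn] := Fconn H HF.
  apply/blockP; split=> // x y xH yH; apply: connect_sub (conn x y xH yH) => a b ab.
  by apply: connect1; move: ab; rewrite HE /adj inE => /andP[].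
apply/setP => H; apply/idP/idP => [HF|/componentsP[C CG ->]].
  have [_ ->] := disjoint_union_part GF HF; exact/imset_f/FG.
have /blockP[[CV _] /set0Pn[x xC] _] := CG.
have := subsetP CV x xC; have [_ -> _] := GF => /bigcupP[K KF xK].
have [_ KE] := disjoint_union_part GF KF.
by rewrite -(block_uniq (FG K KF) CG xK xC) -KE.
Qed.

End Blocks.

(** * Base graphs *)

Section BaseGraphs.
Variables (R : rcfType) (t : R) (T : finType).
Implicit Types (G H K : sgraph T) (S X C : {set T}).

Lemma multv_split G C X : closed_in G C -> X \subset C ->
  multv t (edges G) (vertices G :\: X)
    = (multv t (edges G) (C :\: X) + multv t (edges G) (vertices G :\: C))%N.
Proof.
move=> Cc XC; apply: (multv_disjoint t (@edge_card _ G)).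
- rewrite setDE setDE -[vertices G in LHS](setID _ C) setIUl -!setDE; congr (_ :|: _).
    by rewrite (setIidPr Cc.1).
  by rewrite setDDl (setUidPl XC).
- rewrite disjoint_sym disjoints_subset; apply/subsetP => x.
  by rewrite !inE => /andP[/negPf->]; rewrite andbF.
- by move=> u w /setDP[uC _] /setDP[_ wC]; apply: closed_in_disjoint wC.
Qed.

Lemma multv_split0 G C : closed_in G C ->
  multv t (edges G) (vertices G)
    = (multv t (edges G) C + multv t (edges G) (vertices G :\: C))%N.
Proof. by move=> Cc; have := multv_split Cc (sub0set C); rewrite !setD0. Qed.

Lemma multv_cover (E P : {set {set T}}) : (forall e, e \in E -> #|e| = 2) ->
    trivIset P ->
    (forall C D u w, C \in P -> D \in P -> C != D -> u \in C -> w \in D ->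
       [set u; w] \notin E) ->
  multv t E (cover P) = (\sum_(C in P) multv t E C)%N.
Proof.
move=> E2; have [n] := ubnP #|P|; elim: n P => // n IH P Pn tP PE.
have [->|/set0Pn[C CP]] := eqVneq P set0.
  rewrite /cover !big_set0; apply/eqP; rewrite eqn0Ngt multv_gt0 // wmatch0 ?oner_eq0 //.
  by apply/negP => /E2; rewrite cards0.
rewrite (big_setD1 C) //= -IH; last first.
- by move=> A D u w /setD1P[_ AP] /setD1P[_ DP]; apply: PE.
- by apply: trivIsetS tP; apply: subD1set.
- by rewrite (cardsD1 C P) CP in Pn.
apply: (multv_disjoint t E2) => //.
- by rewrite /cover (big_setD1 C).
- rewrite coverD1 // disjoints_subset; apply/subsetP => x xC.
  by rewrite !inE xC.
- move=> u w uC /bigcupP[D /setD1P[DC DP] wD].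
  by apply: PE uC wD => //; rewrite eq_sym.
Qed.

Lemma mult_blocks G : mult t G = (\sum_(C in blocks G) multv t (edges G) C)%N.
Proof.
rewrite mult_multv -{1}(cover_partition (blocks_partition G)).
apply: (multv_cover (@edge_card _ G)).
  exact: partition_trivIset (blocks_partition G).
move=> C D u w CG DG CD uC wD; have /blockP[Cc _ _] := CG.
apply: closed_in_disjoint Cc uC _; apply: contraNN CD => wC.
by rewrite (block_uniq CG DG wC wD).
Qed.

Lemma critical_block G C : C \in blocks G -> critical t (induced G C) =
  [forall u in C, multv t (edges G) C == (multv t (edges G) (C :\ u)).+1]
    && (multv t (edges G) C == 1).
Proof.
move=> CG; have CV := block_sub CG; rewrite /critical vertices_induced //.
rewrite mult_induced (setIidPr CV); congr (_ && _).
apply: eq_forallb => u; rewrite /essential mult_induced_del_vertices //.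
by rewrite mult_induced (setIidPr CV) eq_sym.
Qed.

Lemma num_critical_blocks G :
  num_critical t G = (\sum_(C in blocks G) critical t (induced G C))%N.
Proof.
rewrite /num_critical -sum1_card big_mkcond /= -big_mkcondl /=.
transitivity (\sum_(H in components G) (critical t H : nat))%N.
  rewrite big_mkcond [RHS]big_mkcond /=; apply: eq_bigr => H _; rewrite !inE.
  by case: (H \in components G); case: critical.
rewrite big_imset //= => C D CG DG eq_ind.
by rewrite -(vertices_induced (block_sub CG)) eq_ind vertices_induced ?block_sub.
Qed.

(** Multiplicity is additive over blocks, and each critical block contributes one. *)
Lemma num_critical_leq G : (num_critical t G <= mult t G)%N.
Proof.
rewrite num_critical_blocks mult_blocks leq_sum // => C CG.
by rewrite critical_block //; case: eqP => [->|_]; rewrite ?andbT ?andbF ?leq_b1.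
Qed.

(** By additivity, a positive vertex of a block would be positive in [G]; Gallai's lemma then leaves
    for each block only multiplicity zero or criticality. *)
Lemma num_critical_no_positive G :
    (forall u, u \in vertices G ->
       multv t (edges G) (vertices G :\ u) <= multv t (edges G) (vertices G))%N ->
  num_critical t G = mult t G.
Proof.
move=> npos; rewrite num_critical_blocks mult_blocks; apply: eq_bigr => C CG.
have /blockP[Cc _ _] := CG.
have Cnpos u : u \in C -> (multv t (edges G) (C :\ u) <= multv t (edges G) C)%N.
  move=> uC; have := npos u (subsetP Cc.1 u uC).
  by rewrite (multv_split Cc) ?sub1set // (multv_split0 Cc) leq_add2r.
rewrite critical_block //; have [->|C0] := posnP (multv t (edges G) C).
  by rewrite andbF.
have [C1 ess] := no_positive_connected (@edge_card _ G) (block_connected_in CG) Cnpos C0.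
rewrite C1 eqxx andbT; apply/eqP; rewrite eqb1; apply/forall_inP => u uC.
by rewrite -(ess u uC) C1.
Qed.

Lemma base_no_extreme_edges H : base_graph t H -> extreme_edges t H = set0.
Proof.
move=> /andP[_ /forallP base]; apply/setP => e; rewrite inE in_set0.
(* A maximal extreme set [A] containing [e] will be a barrier set that is not independent. *)
apply/negP => /andP[eH eext]; have [A maxA eA] := maxset_exists eext.
have /andP[AH /eqP Aext] := maxsetp maxA.
have /eqP/cards2P[u [v [uv eE]]] := edge_card eH.
move: eA; rewrite eE subUset !sub1set => /andP[uA vA].
have barA : barrier_set t H A.
  rewrite /barrier_set AH /= num_critical_no_positive ?Aext //.
  move=> w; rewrite -mult_multv -mult_del_vertices del_vertices_del.
  rewrite !inE => /andP[wH wA]; rewrite leqNgt; apply/negP => lt.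
  (* A positive vertex [w] of the graph without [A] would enlarge [A]. *)
  have ext : extreme_set t H (A :|: [set w]).
    rewrite /extreme_set subUset AH sub1set wH /= setUC cardsU1 wA setUC.
    rewrite eqn_leq addnCA -Aext lt andbT !mult_del_vertices -setDDl add1n.
    exact/multv_del_leq/edge_card.
  have := maxsetsup maxA ext (subsetUl _ _) => AE.
  by rewrite -AE !inE eqxx orbT in wA.
have /implyP/(_ barA)/forall_inP/(_ u uA)/forall_inP/(_ v vA) := base A.
by rewrite /adj -eE eH.
Qed.

(** If a barrier set [S] contains adjacent [x] and [y], deleting [S] leaves multiplicity at least
    [#|S|]. The other [#|S| - 2] vertices account for at most that much, so deleting [x] and [y]
    alone gives multiplicity at least two, and the edge is extreme. *)
Lemma no_extreme_edges_base H : super_positive t H -> extreme_edges t H = set0 ->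
  base_graph t H.
Proof.
move=> sp noext; rewrite /base_graph sp; apply/forallP => S; apply/implyP => barS.
apply/forall_inP => x xS; apply/forall_inP => y yS; apply/negP => xy.
have /andP[SH /eqP] := barS; have /super_positiveP[H0 _] := sp.
have := num_critical_leq (del_vertices H S).
rewrite (mult_multv _ H) H0 add0n mult_del_vertices => le Sc.
suff : [set x; y] \in extreme_edges t H by rewrite noext inE.
rewrite mem_extreme_edges //.
have := multv_setD_leq t (@edge_card _ H) (vertices H :\: [set x; y]) (S :\: [set x; y]).
have xyS : [set x; y] \subset S by rewrite subUset !sub1set xS.
have SE : [set x; y] :|: (S :\: [set x; y]) = S.
  apply/setP => z; rewrite in_setU in_setD; have := subsetP xyS z.
  by case: (z \in [set x; y]) => // ->.
have := cardsD S [set x; y]; rewrite (setIidPr xyS) (edge_card xy) => cS.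
have : (#|[set x; y]| <= #|S|)%N by apply: subset_leq_card.
by rewrite (edge_card xy) setDDl SE; lia.
Qed.

End BaseGraphs.

(** * The decomposition and its uniqueness *)

Theorem theorem5p7 (R : realType) (theta : R) (T : finType) (G : sgraph T)
    (G_super_positive : super_positive theta G) :
  let GY := del_edges G (extreme_edges theta G) in
  (is_disjoint_union GY (components GY) /\
   {in components GY, forall C, base_graph theta C}) /\
  (exists! F : {set sgraph T}, base_decomposition theta G F).
Proof.
move=> GY; have /super_positiveP spG := G_super_positive.
(* Existence takes all extreme edges for [Z]; uniqueness needs an arbitrary set of them. *)
have del (Z : {set {set T}}) : Z \subset extreme_edges theta G ->
    super_positive theta (del_edges G Z) /\
    extreme_edges theta (del_edges G Z) = extreme_edges theta G :\: Z.
  move=> /subsetP ZY.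
  have YE e : e \in extreme_edges theta G -> e \in edges G.
    by rewrite inE => /andP[].
  have [||spZ extZ] := @superpositive_del_edges _ theta _ _ _ Z (@edge_card _ G) spG.
  - by apply/subsetP => e /ZY/YE.
  - by move=> e /ZY eY; rewrite edge_sub -?mem_extreme_edges ?YE.
  have spGZ : super_positive theta (del_edges G Z) by apply/super_positiveP.
  split=> //; apply/setP => e; have [eGZ|eGZ] := boolP (e \in edges G :\: Z).
    have /setDP[eG eZ] := eGZ.
    by rewrite mem_extreme_edges // extZ ?edge_sub // -mem_extreme_edges // in_setD eZ.
  rewrite inE [e \in edges _](negPf eGZ) /=; apply/esym/negP => /setDP[/YE eG eZ].
  by rewrite inE eG eZ in eGZ.
have GYbase : {in components GY, forall C, base_graph theta C}.
  have [/super_positiveP[GY0 GYpos] GYext] := del _ (subxx _).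
  rewrite setDv in GYext; move=> _ /componentsP[C CG ->].
  have /blockP[Cc _ _] := CG; have CV := Cc.1.
  (* The total multiplicity is zero, so the rest of the graph contributes nothing, and deletions
     inside [C] have the same effect in [C] as in [GY]. *)
  have [C0 R0] : multv theta (edges GY) C = 0 /\
      multv theta (edges GY) (vertices GY :\: C) = 0.
    by have := multv_split0 theta Cc; rewrite GY0; lia.
  have spC : super_positive theta (induced GY C).
    apply/super_positiveP; split.
      by rewrite -mult_multv mult_induced (setIidPr CV).
    move=> u; rewrite vertices_induced // => uC.
    rewrite -[X in multv _ _ (X :\ u)](vertices_induced CV).
    rewrite -mult_del_vertices mult_induced_del_vertices //.
    have := GYpos u (subsetP CV u uC).
    by rewrite (multv_split theta Cc) ?sub1set // R0 addn0.
  (* An extreme edge of the component would be extreme in [GY], which has none left. *)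
  apply: no_extreme_edges_base => //; apply/setP => e; rewrite in_set0; apply/negP => eC.
  have eC' : e \in edges (induced GY C) by move: eC; rewrite inE => /andP[].
  have [eG eC2] : e \in edges GY /\ e \subset C by move: eC'; rewrite inE => /andP[].
  move: eC; rewrite mem_extreme_edges // -mult_del_vertices mult_induced_del_vertices // => e0.
  have : e \in extreme_edges theta GY; last by rewrite GYext inE.
  rewrite mem_extreme_edges //; first by rewrite (multv_split theta Cc) // R0 addn0.
  by apply/super_positiveP.
have GYunion := components_disjoint_union GY.
split=> //; exists (components GY); split.
  split; last by exists (extreme_edges theta G).
  by move=> H HF; rewrite (component_connected HF) GYbase.
move=> F [Fbase [Z ZY FZ]].
(* Connected parts are the components of their union, so only [Z] remains to be identified. *)
suff -> : GY = del_edges G Z.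
  by apply/esym/connected_disjoint_union_uniq => // H /Fbase/andP[].
congr del_edges; apply/eqP; rewrite eqEsubset ZY andbT; apply/negPn/negP => YZ.
(* An extreme edge outside [Z] stays extreme after deleting [Z]. The other parts have multiplicity
   zero, so it is also extreme in the part [H] containing it, contrary to
   [base_no_extreme_edges]. *)
have [e eY eZ] := subsetPn YZ.
have [spZ extZ] := del Z ZY; have /super_positiveP[Z0 _] := spZ.
have eext : e \in extreme_edges theta (del_edges G Z) by rewrite extZ in_setD eZ.
have eGZ : e \in edges (del_edges G Z) by move: eext; rewrite inE => /andP[].
have [_ _ EF] := FZ; have := eGZ; rewrite EF => /bigcupP[H HF eH].
have /andP[_ baseH] := Fbase H HF; have [Hc HE] := disjoint_union_part FZ HF.
have := base_no_extreme_edges baseH => /setP/(_ e); rewrite in_set0.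
have /andP[spH _] := baseH; rewrite mem_extreme_edges //.
move: eext; rewrite mem_extreme_edges // (multv_split theta Hc) ?edge_sub //.
have -> : multv theta (edges (del_edges G Z))
    (vertices (del_edges G Z) :\: vertices H) = 0.
  by have := multv_split0 theta Hc; rewrite Z0; lia.
have -> : multv theta (edges H) (vertices H :\: e)
    = multv theta (edges (del_edges G Z)) (vertices H :\: e).
  by rewrite -mult_del_vertices {1}HE mult_induced_del_vertices // Hc.1.
rewrite addn0.
by move=> ->.
Qed.
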